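(* Let $\Psi:\mathbb{R}^n\to\mathbb{R}\cup\{\infty\}$ be proper, closed, and convex, let $\delta\geq 0$, and let $B\in\mathbb{R}^{n\times n}$ be positive definite. For all $x,g\in\mathbb{R}^n$, the set $\mathrm{Prox}^B_\Psi(x,g,\delta)$ is equal to the set of $u\in\mathbb{R}^n$ satisfying $$\left\|r+g+B(u-x)\right\|_B^*\leq\sqrt{2(\delta-\delta')}$$ for some $\delta'\in[0,\delta]$ and some $r\in\partial_{\delta'}\Psi(u)$. In particular, for all $x\in\mathbb{R}^n$, $$\left\{u\in\mathbb{R}^n:\exists\, r\in\partial\Psi(u)\text{ such that }\|u+r-x\|\leq\sqrt{2\delta}\right\}\subseteq\mathrm{Prox}^{I_n}_\Psi(x,0,\delta),$$ where $I_n$ denotes the $n\times n$ identity matrix.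
   Context: $\langle\cdot,\cdot\rangle$ is an inner product on $\mathbb{R}^n$ with induced norm $\|\cdot\|$. Positive definite means self-adjoint with respect to $\langle\cdot,\cdot\rangle$ with $\langle Bx,x\rangle>0$ for $x\neq 0$. $\|\cdot\|_B$ is the norm induced by the inner product $(x,y)\mapsto\langle Bx,y\rangle$, and $\|\cdot\|_B^*$ is its dual norm, which equals $\|\cdot\|_{B^{-1}}$. For $x,g\in\mathbb{R}^n$ and $\delta\geq 0$, the inexact pre-conditioned proximal map is the set $$\mathrm{Prox}^B_\Psi(x,g,\delta):=\Big\{y\in\mathbb{R}^n: \langle g,y\rangle+\tfrac12\|y-x\|_B^2+\Psi(y)\leq\min_{z\in\mathbb{R}^n}\big\{\langle g,z\rangle+\tfrac12\|z-x\|_B^2+\Psi(z)\big\}+\delta\Big\}.$$ For $\delta\ge 0$ and $x\in\mathrm{dom}(\Psi)=\{x:\Psi(x)<\infty\}$, $\partial_\delta\Psi(x)$ is the $\delta$-subdifferential: the set of all $s\in\mathbb{R}^n$ such that $\Psi(y)\geq\Psi(x)+\langle s,y-x\rangle-\delta$ for all $y\in\mathbb{R}^n$; it is empty when $x\notin\mathrm{dom}(\Psi)$. $\partial\Psi=\partial_0\Psi$ is the usual subdifferential. *)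

(* Defs.v *)
From HB Require Import structures.
From mathcomp Require Import all_boot all_order all_algebra.
From mathcomp Require Import all_classical all_reals all_analysis.

Set Implicit Arguments.
Unset Strict Implicit.
Unset Printing Implicit Defensive.

Import Order.TTheory GRing.Theory Num.Theory numFieldNormedType.Exports.

Local Open Scope classical_set_scope.
Local Open Scope ring_scope.

(* Symmetric positive definite bilinear forms on R^n; being definite, each of
   them induces the topology of 'cV[R]_n provided by the library. *)
Notation inner_product R n := {dot 'cV[R]_n for @idfun R}.

Section ConvexFunctions.
Context {R : realType} {n : nat}.
Implicit Types (Psi : 'cV[R]_n -> \bar R).

Definition dom Psi : set 'cV[R]_n := [set x | (Psi x < +oo)%E].

(* The first conjunct says that Psi takes its values in R \cup {+oo}. *)
Definition proper_fun Psi : Prop :=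
  (forall x, Psi x != -oo%E) /\ dom Psi !=set0.

Definition epigraph Psi : set ('cV[R]_n * R) :=
  [set p | (Psi p.1 <= p.2%:E)%E].

Definition closed_fun Psi : Prop := closed (epigraph Psi).

Definition convex_fun Psi : Prop :=
  forall (x y : 'cV[R]_n) (t : R), 0 < t < 1 ->
    (Psi (t *: x + (1 - t) *: y)%R
       <= t%:E * Psi x + (1 - t)%:E * Psi y)%E.

(* m is the minimum of f, which in particular is attained. *)
Definition is_min (f : 'cV[R]_n -> \bar R) (m : \bar R) : Prop :=
  (exists z, f z = m) /\ (forall z, (m <= f z)%E).

End ConvexFunctions.

Section Prox.
Context {R : realType} {n : nat}.
Variable ip : inner_product R n.
Implicit Types (B : 'M[R]_n) (Psi : 'cV[R]_n -> \bar R) (x g : 'cV[R]_n).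

Definition positive_definite B : Prop :=
  (forall x y, ip (B *m x) y = ip x (B *m y)) /\
  (forall x, x != 0 -> 0 < ip (B *m x) x).

Definition normI x : R := Num.sqrt (ip x x).

Definition normB B x : R := Num.sqrt (ip (B *m x) x).

Definition dual_norm (N : 'cV[R]_n -> R) (s : 'cV[R]_n) : R :=
  sup [set ip s x | x in [set x | N x <= 1]].

Definition subdiff (delta : R) Psi x : set 'cV[R]_n :=
  [set s | dom Psi x /\
     forall y, (Psi x + (ip s (y - x))%:E - delta%:E <= Psi y)%E].

Definition prox_objective B Psi x g (z : 'cV[R]_n) : \bar R :=
  ((ip g z + 2^-1 * normB B (z - x) ^+ 2)%:E + Psi z)%E.

Definition Prox B Psi x g (delta : R) : set 'cV[R]_n :=
  [set y | exists m, is_min (prox_objective B Psi x g) m /\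
     (prox_objective B Psi x g y <= m + delta%:E)%E].

End Prox.

(* Main.v *)
Require Import Defs.
From HB Require Import structures.
From mathcomp Require Import all_boot all_order all_algebra.
From mathcomp Require Import all_classical all_reals all_analysis.
From mathcomp Require Import ring lra.

(* A minimizer z of the prox objective satisfies r := - (g + B (z - x)) \in
   \partial Psi(z) by Fermat's rule. If u is a delta-minimizer, then r is a
   delta'-subgradient at u for delta' := Psi u - Psi z - <r, u - z>, while
   r + g + B (u - x) = B (u - z) has dual norm |u - z|_B; expanding the
   quadratic term around z, the objective gap between u and z is exactly
   delta' + |u - z|_B^2 / 2. Conversely, expanding around u and completing the
   square bounds the objective from below by its value at u minus delta. The
   minimum is attained because minimizing sequences are Cauchy by strong
   convexity and the epigraph of Psi is closed. *)

Import Order.TTheory GRing.Theory Num.Theory numFieldNormedType.Exports.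

Local Open Scope classical_set_scope.
Local Open Scope ring_scope.

(** * Inner products on R^n: Cauchy-Schwarz, coordinate bounds, continuity *)

Section InnerProduct.
Context {R : realType} {n : nat}.
Implicit Types (ip : inner_product R n) (B : 'M[R]_n) (x y z w d : 'cV[R]_n).

Lemma ip_sym ip x y : ip x y = ip y x.
Proof. by rewrite (hermC (ip : {symmetric _})) /= expr0 mul1r. Qed.

Lemma ipDl ip x y z : ip (x + y) z = ip x z + ip y z.
Proof. exact: linearDl. Qed.

Lemma ipDr ip x y z : ip x (y + z) = ip x y + ip x z.
Proof. exact: linearDr. Qed.

Lemma ipNr ip x y : ip x (- y) = - ip x y.
Proof. exact: linearNr. Qed.

Lemma ipBl ip x y z : ip (x - y) z = ip x z - ip y z.
Proof. exact: linearBl. Qed.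

Lemma ipBr ip x y z : ip x (y - z) = ip x y - ip x z.
Proof. exact: linearBr. Qed.

Lemma ipZl ip (a : R) x y : ip (a *: x) y = a * ip x y.
Proof. exact: linearZl_LR. Qed.

Lemma ipZr ip (a : R) x y : ip x (a *: y) = a * ip x y.
Proof. exact: linearZr_LR. Qed.

Lemma ip0l ip x : ip 0 x = 0.
Proof. exact: linear0l. Qed.

Lemma ip0r ip x : ip x 0 = 0.
Proof. exact: linear0r. Qed.

Lemma ip_ge0 ip x : 0 <= ip x x.
Proof.
have [->|x0] := eqVneq x 0; first by rewrite ip0r.
exact/ltW/neq0_dnorm_gt0.
Qed.

Lemma ip_eq0 ip x : ip x x = 0 -> x = 0.
Proof.
move=> xx0; apply/eqP; apply: contraT => x0.
have : 0 < ip x x by exact: neq0_dnorm_gt0.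
by rewrite xx0 ltxx.
Qed.

Lemma ip_sqrD ip x y : ip (x + y) (x + y) = ip x x + 2 * ip x y + ip y y.
Proof. rewrite ipDl !ipDr (ip_sym ip y x); ring. Qed.

Lemma normI_ge0 ip x : 0 <= normI ip x.
Proof. exact: sqrtr_ge0. Qed.

Lemma sqr_normI ip x : normI ip x ^+ 2 = ip x x.
Proof. by rewrite sqr_sqrtr // ip_ge0. Qed.

Lemma normI_eq0 ip x : normI ip x = 0 -> x = 0.
Proof. by move=> x0; apply: (@ip_eq0 ip); rewrite -sqr_normI x0 expr0n. Qed.

Lemma normIZ ip (a : R) x : normI ip (a *: x) = `|a| * normI ip x.
Proof.
by rewrite /normI ipZl ipZr mulrA -expr2 sqrtrM ?sqr_ge0// sqrtr_sqr.
Qed.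

(** With [a] and [b] the norms of [x] and [y], the squared norm of [b *: x - a *: y] factors as
    [2 * (a * b) * (a * b - c)]. Zero norms are set apart so that [a * b] can be cancelled. *)
Lemma ip_CauchySchwarz ip x y : ip x y <= normI ip x * normI ip y.
Proof.
set a := normI ip x; set b := normI ip y.
have [x0|x0] := eqVneq a 0.
  by rewrite (normI_eq0 _ _ x0) ip0l mulr_ge0 // normI_ge0.
have [y0|y0] := eqVneq b 0.
  by rewrite (normI_eq0 _ _ y0) ip0r mulr_ge0 // normI_ge0.
have a0 : 0 < a by rewrite lt0r x0 normI_ge0.
have b0 : 0 < b by rewrite lt0r y0 normI_ge0.
have := ip_ge0 ip (b *: x + (- a) *: y).
rewrite ip_sqrD !ipZl !ipZr -!sqr_normI -/a -/b.
set c := ip x y.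
have -> : b * (b * a ^+ 2) + 2 * (b * (- a * c)) + - a * (- a * b ^+ 2)
  = 2 * (a * b) * (a * b - c) by ring.
by rewrite pmulr_rge0 ?subr_ge0 // !mulr_gt0.
Qed.

(** A row of the kernel of the transpose of [B], once transposed, is a vector that [B] sends to
    zero. *)
Lemma unitmx_injective B : (forall x, B *m x = 0 -> x = 0) -> B \in unitmx.
Proof.
move=> Binj; rewrite -unitmx_tr -row_free_unit -kermx_eq0.
apply/eqP/row_matrixP => i; rewrite row0.
apply: trmx_inj; rewrite trmx0; apply: Binj.
rewrite -{1}[B]trmxK -trmx_mul; apply: trmx_inj; rewrite trmxK trmx0.
by apply/sub_kermxP/row_sub.
Qed.

Lemma ip_sum_coord ip x y :
  ip x y = \sum_i x i 0 * ip (delta_mx i 0) y.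
Proof.
rewrite [in LHS](matrix_sum_delta x) (linear_sumlz ip).
by apply: eq_bigr => i _; rewrite big_ord1; exact: ipZl.
Qed.

(** Each coordinate is the inner product with a fixed vector, so Cauchy-Schwarz applies. This
    carries Cauchy estimates from the norm of [ip] to the entrywise topology. *)
Lemma coord_le_normI ip :
  exists2 C : R, 0 <= C & forall x (i : 'I_n), `|x i 0| <= C * normI ip x.
Proof.
(* Gram matrix of the standard basis. It is invertible by definiteness, and the rows of its inverse
   represent the coordinate functionals. *)
pose M : 'M[R]_n := \matrix_(i, j) ip (delta_mx i 0) (delta_mx j 0).
have MxE x i : (M *m x) i 0 = ip (delta_mx i 0) x.
  rewrite ip_sym ip_sum_coord mxE; apply: eq_bigr => j _.
  by rewrite mxE ip_sym mulrC.
have Munit : M \in unitmx.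
  apply: unitmx_injective => x Mx0; apply: (@ip_eq0 ip).
  by rewrite ip_sum_coord big1 // => i _; rewrite -MxE Mx0 mxE mulr0.
pose w i : 'cV[R]_n := (row i (invmx M))^T.
have wE x i : ip (w i) x = x i 0.
  rewrite ip_sum_coord -[in RHS](mulKmx Munit x) [RHS]mxE.
  by apply: eq_bigr => j _; rewrite MxE !mxE.
exists (\sum_i normI ip (w i)).
  by apply: sumr_ge0 => i _; exact: normI_ge0.
move=> x i; apply: (@le_trans _ _ (normI ip (w i) * normI ip x)).
  rewrite -wE ler_norml ip_CauchySchwarz andbT lerNl -ipNr.
  by rewrite (le_trans (ip_CauchySchwarz _ _ _)) // -scaleN1r normIZ normrN1 mul1r.
rewrite ler_wpM2r ?normI_ge0 // (bigD1 i) //= lerDl.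
by apply: sumr_ge0 => j _; exact: normI_ge0.
Qed.

Lemma continuous_ip ip y : continuous (fun x => ip x y).
Proof.
have -> : (fun x => ip x y) = (fun x => \sum_i x i 0 * ip (delta_mx i 0) y).
  by apply/funext => x; exact: ip_sum_coord.
apply: continuous_big => [|i _ x]; first exact: add_continuous.
exact: cvgM (@coord_continuous R n 1 i 0 x) (cvg_cst _).
Qed.

Lemma continuous_sqr_ip ip y : continuous (fun x => ip (x - y) (x - y)).
Proof.
have -> : (fun x => ip (x - y) (x - y)) =
    (fun x => \sum_i (x i 0 - y i 0) *
       (ip x (delta_mx i 0) - ip y (delta_mx i 0))).
  apply/funext => x; rewrite ip_sum_coord; apply: eq_bigr => i _.
  by rewrite !mxE ip_sym ipBl.
apply: continuous_big => [|i _ x]; first exact: add_continuous.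
exact: cvgM (cvgB (@coord_continuous R n 1 i 0 x) (cvg_cst _))
  (cvgB (@continuous_ip ip (delta_mx i 0) x) (cvg_cst _)).
Qed.

(** Once packaged as an inner product, the form of [B] inherits Cauchy-Schwarz and the coordinate
    bound. *)
Lemma inner_product_of {ip B} : positive_definite ip B ->
  exists b : inner_product R n, forall x y, b x y = ip (B *m x) y.
Proof.
move=> [Bsym Bpos].
pose b := fun x y => ip (B *m x) y.
have bC x y : b x y = (-1) ^+ false * idfun (b y x).
  by rewrite expr0 mul1r /b Bsym ip_sym.
have bpos x : x != 0 -> 0 < b x x by exact: Bpos.
have bl y : zmod_morphism (b ^~ y).
  by move=> u v; rewrite /b linearBr /= ipBl.
have br x : zmod_morphism (b x).
  by move=> u v; rewrite /b /= ipBr.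
have bZl y : scalable_for *%R (b ^~ y).
  by move=> a u; rewrite /b linearZ /= ipZl.
have bZr x : scalable_for (idfun \; *%R) (b x).
  by move=> a u; rewrite /b /= ipZr.
pose b0 := isBilinear.Build R 'cV[R]_n 'cV[R]_n R *%R (idfun \; *%R) b
  bl br bZl bZr.
pose b1 := isHermitianSesquilinear.Build R 'cV[R]_n false idfun b bC.
pose b2 := isDotProduct.Build R 'cV[R]_n b bpos.
pose bb : inner_product R n := HB.pack b b0 b1 b2.
by exists bb.
Qed.

End InnerProduct.

(** * The proximal objective: expansion, existence of a minimizer, optimality condition *)

Definition prox_quad {R : realType} {n : nat} (ip b : inner_product R n)
    (x g z : 'cV[R]_n) : R :=
  ip g z + 2^-1 * b (z - x) (z - x).

Section Quadratic.
Context {R : realType} {n : nat}.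
Context {ip b : inner_product R n} {x g : 'cV[R]_n}.
Implicit Types (a c d u z : 'cV[R]_n) (Psi : 'cV[R]_n -> \bar R).
Local Notation quad := (prox_quad ip b x g).

(** Exact second-order Taylor expansion at [z]; the linear term pairs [d] with the gradient. *)
Lemma prox_quadD z d :
  quad (z + d) = quad z + (ip g d + b (z - x) d) + 2^-1 * b d d.
Proof.
rewrite /prox_quad (addrAC z d) (ip_sqrD b (z - x) d) ipDr.
by field.
Qed.

Lemma continuous_quad : continuous quad.
Proof.
move=> z; apply: (cvgD (F := nbhs z)).
  have -> : (ip g : 'cV[R]_n -> R) = (fun y => ip y g).
    by apply/funext => y; exact: ip_sym.
  exact: continuous_ip.
exact: cvgM (cvg_cst _) (@continuous_sqr_ip _ _ b x z).
Qed.

(** Turns inequalities between extended reals into real ones, which [lra] can combine. *)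
Lemma proper_fin {Psi z} {q v : R} : proper_fun Psi ->
  (q%:E + Psi z <= v%:E)%E -> exists2 p : R, Psi z = p%:E & q + p <= v.
Proof.
move=> [/(_ z) + _]; case: (Psi z) => [p|//|//] _.
by rewrite -EFinD lee_fin => ?; exists p.
Qed.

(* The objective is strongly convex: comparing two near-minimizers with their
   midpoint shows that they are close to each other. *)
Lemma near_minimizers_close {Psi} {m e : R} {a c} :
  proper_fun Psi -> convex_fun Psi ->
  (forall z, m%:E <= (quad z)%:E + Psi z)%E ->
  ((quad a)%:E + Psi a <= (m + e)%:E)%E ->
  ((quad c)%:E + Psi c <= (m + e)%:E)%E ->
  b (a - c) (a - c) <= 8 * e.
Proof.
move=> Ppr Pcv mlb /(proper_fin Ppr)[pa Pa ha] /(proper_fin Ppr)[pc Pc hc].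
pose h := 2^-1 *: (a + c); pose d := 2^-1 *: (a - c).
have aE : a = h + d by apply/matrixP => i j; rewrite !mxE; field.
have cE : c = h - d by apply/matrixP => i j; rewrite !mxE; field.
have acE : a - c = 2 *: d.
  by rewrite /d scalerA mulfV ?pnatr_eq0// scale1r.
clearbody d; have : (Psi h <= (2^-1 * pa + 2^-1 * pc)%:E)%E.
  have t01 : 0 < (2^-1 : R) < 1 by apply/andP; split; lra.
  have := Pcv a c 2^-1 t01.
  have -> : 1 - 2^-1 = 2^-1 :> R by field.
  by rewrite -scalerDr Pa Pc -!EFinM -EFinD.
rewrite -[leLHS]add0e => /(proper_fin Ppr)[ph Ph hp].
have := mlb h; rewrite Ph -EFinD lee_fin => mh.
(* The linear terms at [h + d] and [h - d] cancel in the sum, which leaves [b d d <= 2 * e];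
   doubling [d] multiplies this by 4. *)
have qa : quad a = _ := etrans (congr1 _ aE) (prox_quadD h d).
have qc : quad c = _ := etrans (congr1 _ cE) (prox_quadD h (- d)).
move: qa qc; rewrite acE !ipNr ipZl ipZr (ip_sym b (- d)) ipNr => qa qc.
lra.
Qed.

Lemma prox_quad_attained {Psi} {l : R} :
  proper_fun Psi -> closed_fun Psi -> convex_fun Psi ->
  (forall z, l%:E <= (quad z)%:E + Psi z)%E ->
  exists m, is_min (fun z => (quad z)%:E + Psi z)%E m.
Proof.
move=> Ppr Pcl Pcv llb.
(* Real upper bounds of objective values, so that the infimum is taken among real numbers. *)
pose S := [set v : R | exists z, ((quad z)%:E + Psi z <= v%:E)%E].
have Slb : lbound S l.
  by move=> v [z zv]; rewrite -lee_fin; exact: le_trans (llb z) zv.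
have S0 : S !=set0.
  case: (Ppr) => P_ [z zdom]; move: (P_ z) zdom; rewrite /dom /=.
  case Pz : (Psi z) => [p| |] // _ _.
  by exists (quad z + p), z; rewrite Pz EFinD.
have Sinf : has_inf S by split => //; exists l.
set m := inf S.
have mlb z : (m%:E <= (quad z)%:E + Psi z)%E.
  case Pz : (Psi z) => [p| |].
  - rewrite -EFinD lee_fin; apply: ge_inf; first by exists l.
    by exists z; rewrite Pz EFinD.
  - by rewrite addey // leey.
  - by case: Ppr => /(_ z); rewrite Pz.
have /choice[u uP] : forall k : nat, exists z,
    ((quad z)%:E + Psi z <= (m + k.+1%:R^-1)%:E)%E.
  move=> k; have k0 : 0 < k.+1%:R^-1 :> R by rewrite invr_gt0 ltr0n.
  have [v [z zv] /ltW vm] := inf_adherent k0 Sinf.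
  by exists z; apply: le_trans zv _; rewrite lee_fin.
have [C C0 CP] := coord_le_normI b.
have u_cauchy : cauchy (u @ \oo).
  apply: cauchy_exP => e e0.
  (* Chosen so that [C ^+ 2 * (8 * e')] is below [e ^+ 2]; the added 1 keeps the denominator
     positive when [C] is 0. *)
  pose e' : R := e ^+ 2 / (8 * C ^+ 2 + 1).
  have D0 : 0 < 8 * C ^+ 2 + 1 by have := sqr_ge0 C; lra.
  have e'0 : 0 < e' by rewrite divr_gt0 // exprn_gt0.
  have [N _ NP] := near_infty_natSinv_lt (PosNum e'0).
  exists (u N); exists N => // k /= Nk.
  split => // i j; rewrite ord1 -ball_normE /ball_ /=.
  have uk : b (u N - u k) (u N - u k) <= 8 * N.+1%:R^-1.
    apply: near_minimizers_close Ppr Pcv mlb (uP N) _.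
    apply: le_trans (uP k) _; rewrite lee_fin lerD2l lef_pV2 ?posrE ?ltr0n //.
    by rewrite ler_nat.
  have := CP (u N - u k) i; rewrite !mxE => cuk.
  apply: le_lt_trans cuk _.
  rewrite -(@ltr_pXn2r _ 2) ?nnegrE ?mulr_ge0 ?normI_ge0 ?(ltW e0) //.
  rewrite exprMn sqr_normI.
  have := NP N (leqnn N); rewrite /= /e' ltr_pdivlMr // => Ne.
  apply: le_lt_trans Ne.
  have := ler_wpM2l (sqr_ge0 C) uk.
  have : 0 <= N.+1%:R^-1 :> R by rewrite invr_ge0.
  move: (N.+1%:R^-1 : R) (b _ _) => r s; lra.
have [z0 uz0] : exists z0, u @ \oo --> z0.
  by apply/cvg_ex; exact: cauchy_cvg.
(* The points [w k] lie in the epigraph and converge to this one; the 0 is the limit of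
   [k.+1%:R^-1]. *)
have z0epi : epigraph Psi (z0, m + 0 - quad z0).
  pose w k := (u k, m + k.+1%:R^-1 - quad (u k)).
  apply: (@closed_cvg _ _ (\oo) _ w (epigraph Psi)) => //.
    apply: nearW => k; rewrite /epigraph /=.
    have [p -> ukp] := proper_fin Ppr (uP k).
    by rewrite lee_fin lerBrDl.
  have quz0 := cvg_comp _ _ uz0 (@continuous_quad z0).
  exact: cvg_pair uz0 (cvgB (cvgD (cvg_cst m) cvg_harmonic) quz0).
exists m%:E; split => //; exists z0; apply/eqP; rewrite eq_le mlb andbT.
move: z0epi; rewrite /epigraph /= addr0 -[leLHS]add0e.
move=> /(proper_fin Ppr)[p -> ?].
by rewrite -EFinD lee_fin; lra.
Qed.

(** Fermat's rule: were the inequality to fail at [y], a short step from [z] towards [y] would lower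
    the objective, by convexity of [Psi]. *)
Lemma minimizer_subgradient {Psi z y} {p : R} :
  proper_fun Psi -> convex_fun Psi -> Psi z = p%:E ->
  (forall v, (quad z)%:E + Psi z <= (quad v)%:E + Psi v)%E ->
  ((p - (ip g (y - z) + b (z - x) (y - z)))%:E <= Psi y)%E.
Proof.
move=> Ppr Pcv Pz zmin.
case Py : (Psi y) => [v| |]; [|by rewrite leey|by case: Ppr => /(_ y); rewrite Py].
rewrite lee_fin leNgt; apply/negP => A0.
pose d := y - z.
set A := ip g d + b (z - x) d + v - p.
have {}A0 : A < 0 by rewrite /A /d; lra.
have D0 := ip_ge0 b d; set D := b d d in D0.
(* A step short enough for the first-order decrease t A along the segment
   [z, y] to dominate the quadratic term t^2 D / 2. *)
pose t := - A / (D - 2 * A).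
have den0 : 0 < D - 2 * A by lra.
have tE : t * (D - 2 * A) = - A by rewrite /t divfK // gt_eqF.
have t0 : 0 < t by rewrite /t divr_gt0 //; lra.
have t1 : t < 1 by rewrite /t ltr_pdivrMr //; lra.
have tcv : t *: y + (1 - t) *: z = z + t *: d.
  by rewrite /d scalerBl scale1r scalerBr addrCA addrA.
have t01 : 0 < t < 1 by rewrite t0 t1.
have := Pcv y z t t01; rewrite tcv Py Pz -!EFinM -EFinD.
rewrite -[leLHS]add0e => /(proper_fin Ppr)[s Ps hs].
have := zmin (z + t *: d); rewrite Pz Ps -!EFinD lee_fin prox_quadD.
rewrite !ipZr ipZl -/D => h.
have : 0 <= t * (A + 2^-1 * (t * D)) by rewrite /A; nra.
rewrite pmulr_rge0 // => h2.
have : t * A < 0 by rewrite pmulr_rlt0.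
lra.
Qed.

End Quadratic.

(** * The dual norm and the two inclusions *)

Section ProxSubdiff.
Context {R : realType} {n : nat}.
Context {ip : inner_product R n}.
Implicit Types (B : 'M[R]_n) (x g u s w z : 'cV[R]_n).
Implicit Types (Psi : 'cV[R]_n -> \bar R).

(** Cauchy-Schwarz bounds the supremum, and the normalization of the representing vector [w] attains
    it. *)
Lemma dual_normE {b : inner_product R n} {s w} :
  (forall v, ip s v = b w v) -> dual_norm ip (normI b) s = normI b w.
Proof.
move=> sw; rewrite /dual_norm; set S := (X in sup X).
have Sub : ubound S (normI b w).
  move=> _ [v /= v1 <-]; rewrite sw.
  apply: le_trans (ip_CauchySchwarz _ _ _) _.
  by rewrite ler_piMr // normI_ge0.
apply/eqP; rewrite eq_le; apply/andP; split.
  by apply: ge_sup => //; exists (ip s 0), 0; rewrite //= /normI ip0r sqrtr0.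
apply: ub_le_sup; first by exists (normI b w).
(* If the norm is 0, its inverse is 0 by convention and the witness is the zero vector. *)
exists ((normI b w)^-1 *: w) => /=.
  rewrite normIZ ger0_norm ?invr_ge0 ?normI_ge0 //.
  have [->|w0] := eqVneq (normI b w) 0; first by rewrite mulr0.
  by rewrite mulVf.
rewrite sw ipZr -sqr_normI.
have [->|w0] := eqVneq (normI b w) 0; first by rewrite expr0n mulr0.
by rewrite expr2 mulKf.
Qed.

Lemma dual_normB {b : inner_product R n} {B} w :
  (forall y z, b y z = ip (B *m y) z) ->
  dual_norm ip (normB ip B) (B *m w) = normI b w.
Proof.
move=> bE; have -> : normB ip B = normI b.
  by apply/funext => y; rewrite /normB /normI bE.
by apply: dual_normE => v; rewrite bE.
Qed.

Lemma prox_objectiveE {b : inner_product R n} {B} Psi x g :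
  (forall y z, b y z = ip (B *m y) z) ->
  prox_objective ip B Psi x g =
  (fun z => (prox_quad ip b x g z)%:E + Psi z)%E.
Proof.
move=> bE; apply/funext => z; rewrite /prox_objective /prox_quad /normB -bE.
by rewrite sqr_sqrtr // ip_ge0.
Qed.

Lemma Prox_subset Psi (delta : R) B x g :
  proper_fun Psi -> convex_fun Psi -> positive_definite ip B ->
  Prox ip B Psi x g delta `<=`
  [set u | exists delta' : R, 0 <= delta' <= delta /\
     exists r : 'cV[R]_n, subdiff ip delta' Psi u r /\
       dual_norm ip (normB ip B) (r + g + B *m (u - x))
         <= Num.sqrt (2 * (delta - delta'))].
Proof.
move=> Ppr Pcv /inner_product_of[b bE] u [_ [[[z <-] zmin]]].
rewrite (prox_objectiveE _ _ _ bE) in zmin * => umin.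
(* Comparison with a point of the domain shows that the minimum is finite. *)
have [z0 z0dom] := Ppr.2.
have [p Pz _] : exists2 p : R, Psi z = p%:E &
    prox_quad ip b x g z + p <= prox_quad ip b x g z0 + fine (Psi z0).
  apply: (proper_fin Ppr); apply: le_trans (zmin z0) _.
  by rewrite [leRHS]EFinD fineK // fin_numE (Ppr.1 z0) lt_eqF.
have {umin}[pu Pu umin] : exists2 p' : R, Psi u = p'%:E &
    prox_quad ip b x g u + p' <= prox_quad ip b x g z + p + delta.
  by apply: (proper_fin Ppr); rewrite [leRHS]EFinD [(_ + p)%:E]EFinD -Pz.
pose r := - (g + B *m (z - x)).
have rE v : ip r v = - (ip g v + b (z - x) v).
  by rewrite /r ip_sym ipNr ip_sym ipDl bE.
have rsub y : ((p + ip r (y - z))%:E <= Psi y)%E.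
  by rewrite rE; exact: minimizer_subgradient Ppr Pcv Pz zmin.
have := @prox_quadD _ _ ip b x g z (u - z); rewrite subrKC => qu.
have := ip_ge0 b (u - z) => uz0.
have := rsub u; rewrite Pu lee_fin => ur.
exists (pu - p - ip r (u - z)); split.
  by move: ur; rewrite rE => ur; apply/andP; split; lra.
exists r; split.
  split; first by rewrite /dom /= Pu ltry.
  move=> y; apply: le_trans (rsub y).
  by rewrite Pu -EFinD lee_fin !ipBr; lra.
have -> : r + g + B *m (u - x) = B *m (u - z).
  rewrite /r opprD (addrAC (- g)) addNr add0r -mulmxN -mulmxDr.
  by congr (B *m _); rewrite addrC opprB subrKA.
by rewrite (dual_normB _ bE) ler_wsqrtr // rE; lra.
Qed.

Lemma subset_Prox Psi (delta : R) B x g :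
  proper_fun Psi -> closed_fun Psi -> convex_fun Psi ->
  positive_definite ip B ->
  [set u | exists delta' : R, 0 <= delta' <= delta /\
     exists r : 'cV[R]_n, subdiff ip delta' Psi u r /\
       dual_norm ip (normB ip B) (r + g + B *m (u - x))
         <= Num.sqrt (2 * (delta - delta'))] `<=`
  Prox ip B Psi x g delta.
Proof.
move=> Ppr Pcl Pcv Bpd u [delta' [/andP[d0 dd] [r [[udom usub] snorm]]]].
have [b bE] := inner_product_of Bpd.
set s := r + g + B *m (u - x) in snorm.
have Bunit : B \in unitmx.
  apply: unitmx_injective => y By0; apply: (ip_eq0 b).
  by rewrite bE By0 ip0l.
have sE : s = B *m (invmx B *m s) by rewrite mulKVmx.
(* Represents [s] with respect to [b], so the dual norm of [s] is the norm of [w]. *)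
set w := invmx B *m s in sE.
have ww : b w w <= 2 * (delta - delta').
  move: snorm; rewrite sE (dual_normB _ bE) /normI ler_sqrt //.
  by rewrite mulr_ge0 // subr_ge0.
have [pu Pu _] : exists2 p : R, Psi u = p%:E & 0 + p <= fine (Psi u).
  by apply: (proper_fin Ppr); rewrite add0e fineK // fin_numE (Ppr.1 u) lt_eqF.
(* With [d := y - u], nonnegativity of [b (w + d) (w + d)] bounds [b w d + b d d / 2] below by
   [- b w w / 2], hence by [delta' - delta]. The subgradient inequality loses the other [delta'].
   The bound also yields existence of the minimum. *)
have lb y : ((prox_quad ip b x g u + pu - delta)%:E <=
             (prox_quad ip b x g y)%:E + Psi y)%E.
  apply: le_trans _ (leeD2l _ (usub y)).
  rewrite Pu -!EFinD lee_fin.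
  have := @prox_quadD _ _ ip b x g u (y - u); rewrite subrKC => ->.
  set d := y - u.
  have swd : b w d = ip r d + ip g d + b (u - x) d.
    by rewrite bE -sE /s 2!ipDl bE.
  have := ip_ge0 b (w + d); rewrite ip_sqrD => wd.
  lra.
have [m mmin] := prox_quad_attained Ppr Pcl Pcv lb.
rewrite /Prox /= (prox_objectiveE _ _ _ bE); exists m; split=> //.
case: mmin => -[z <-] _; by rewrite Pu -leeBlDr.
Qed.

End ProxSubdiff.

Theorem corollary2p4 (R : realType) (n : nat) (ip : inner_product R n)
    (Psi : 'cV[R]_n -> \bar R)
    (Psi_proper : proper_fun Psi) (Psi_closed : closed_fun Psi)
    (Psi_convex : convex_fun Psi)
    (delta : R) (delta_ge0 : 0 <= delta)
    (B : 'M[R]_n) (B_pd : positive_definite ip B) :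
  (forall x g : 'cV[R]_n,
     Prox ip B Psi x g delta =
     [set u | exists delta' : R, 0 <= delta' <= delta /\
        exists r : 'cV[R]_n, subdiff ip delta' Psi u r /\
          dual_norm ip (normB ip B) (r + g + B *m (u - x))
            <= Num.sqrt (2 * (delta - delta'))]) /\
  (forall x : 'cV[R]_n,
     [set u | exists r : 'cV[R]_n, subdiff ip 0 Psi u r /\
        normI ip (u + r - x) <= Num.sqrt (2 * delta)]
     `<=` Prox ip 1%:M Psi x 0 delta).
Proof.
split=> [x g|x u [r [rsub rnorm]]].
  by apply/seteqP; split; [exact: Prox_subset|exact: subset_Prox].
have one_pd : positive_definite ip 1%:M.
  by split=> [y z|y y0]; rewrite ?mul1mx //; exact: neq0_dnorm_gt0.
apply: subset_Prox => //.
(* Exact subgradients leave the whole tolerance [delta] to the norm term. *)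
exists 0; split; first by rewrite lexx.
exists r; split => //.
rewrite addr0 -[r + _]mul1mx mul1mx.
have -> : r + 1%:M *m (u - x) = 1%:M *m (u + r - x).
  by rewrite !mul1mx addrCA addrA.
rewrite (dual_normB (b := ip)) ?subr0 // => y z.
by rewrite mul1mx.
Qed.
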